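(* Let $T$ be a complete first order theory in a countable signature, and consider ternary relations on small subsets of its big model. (1) $T$ has the exchange property if and only if $T$ is real rosy and $\downarrow^{\mathrm{th}}=\downarrow^{e}$. (2) If $T$ has the exchange property, then $\downarrow^{\mathrm{th}}$ has small local character. (3) If $T$ is stable and $\downarrow^{d}=\downarrow^{e}$, then $T$ has the exchange property.
   Context: $\upsilon$ is a fixed uncountable inaccessible cardinal; the big model $\mathcal M$ of $T$ is its saturated model of cardinality $\upsilon$ (or its finite model). Small means of cardinality $<\upsilon$. All sets $A,B,C,\dots$ are small subsets of $\mathcal M$; $AB$ means $A\cup B$; $[A,B]=\{D:A\subseteq D\subseteq B\}$; $A'\equiv_C A$ means equal types over $C$ (under corresponding enumerations); $\mathrm{acl}$ is model-theoretic algebraic closure in $\mathcal M$. Exchange property: $a\in\mathrm{acl}(bC)\setminus\mathrm{acl}(C)$ implies $b\in\mathrm{acl}(aC)$. $A\downarrow^{e}_C B$ iff for all finite tuples $\bar a$ from $A$ (possibly empty), $A\cap\mathrm{acl}(\bar aBC)\subseteq\mathrm{acl}(\bar aC)$. $A\downarrow^a_C B$ iff $\mathrm{acl}(AC)\cap\mathrm{acl}(BC)=\mathrm{acl}(C)$. $A\downarrow^M_C B$ iff $A\downarrow^a_D B$ for every $D\in[C,\mathrm{acl}(BC)]$. Thorn independence: $A\downarrow^{\mathrm{th}}_C B$ iff for every small $E\supseteq BC$ there is $A'\equiv_{BC}A$ with $A'\downarrow^M_C E$. $T$ is real rosy if $\downarrow^{\mathrm{th}}$ has local character: for every $A$ there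 is a cardinal $\kappa(A)<\upsilon$ such that every $B$ has a subset $C$ with $|C|<\kappa(A)$ and $A\downarrow^{\mathrm{th}}_C B$. $A\downarrow^d_C B$ (dividing independence) iff there is no tuple $\bar a$ from $A$ and formula $\varphi(\bar x)$ with parameters in $BC$ such that $\varphi(\bar a)$ holds and $\varphi(\bar x)$ divides over $C$. A ternary relation $\downarrow$ has small local character if for all small $A,B,C_0$ with $C_0\subseteq B$ and $|C_0|\le|A|+\aleph_0$ there is $C\in[C_0,B]$ with $|C|\le|A|+\aleph_0$ and $A\downarrow_C B$. *)

(* Defs.v *)
From mathcomp Require Import all_boot.
From mathcomp Require Import boolp classical_sets functions cardinality.

Set Implicit Arguments.
Unset Strict Implicit.
Unset Printing Implicit Defensive.

Local Open Scope classical_set_scope.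
Local Open Scope card_scope.

(** * Cardinals *)

Definition card_lt (X Y : Type) (A : set X) (B : set Y) : Prop :=
  A #<= B /\ ~ (B #<= A).

(* Cardinals are represented by sets: [U] stands for its own cardinality
   upsilon, and the cardinals below upsilon are those of the subsets [K] of [U]
   with [card_lt K [set: U]].
   Regularity is stated as: upsilon is not a union of fewer than upsilon sets of
   cardinality less than upsilon. *)
Definition inaccessible (U : Type) : Prop :=
  [/\ ~ countable [set: U],
      (forall (I : set U) (F : U -> set U),
          card_lt I [set: U] ->
          (forall i, I i -> card_lt (F i) [set: U]) ->
          card_lt (\bigcup_(i in I) F i) [set: U])
    & (forall K : set U,
          card_lt K [set: U] -> card_lt [set X : set U | X `<=` K] [set: U])].

Definition small (U M : Type) (A : set M) : Prop := card_lt A [set: U].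

(* The disjoint union of [A] and [nat], of cardinality |A| + aleph_0. *)
Definition plus_aleph0 (M : Type) (A : set M) : set (M + nat) :=
  [set x | match x with inl a => A a | inr _ => True end].

(** * First-order logic *)

Record signature := Signature {
  fsym : Type;
  rsym : Type;
  farity : fsym -> nat;
  rarity : rsym -> nat }.

Definition countable_signature (L : signature) : Prop :=
  countable [set: fsym L] /\ countable [set: rsym L].

(* [term L n] and [formula L n]: free variables among x_0, ..., x_(n-1). *)
Inductive term (L : signature) (n : nat) : Type :=
| Var of 'I_n
| App (f : fsym L) of ('I_(farity f) -> term L n).

(* In [FAll p] the bound variable of [p] is x_0, and the other variables of [p]
   are shifted by one. *)
Inductive formula (L : signature) : nat -> Type :=
| FFalse n : formula L n
| FEq n of term L n & term L n : formula L n
| FRel n (r : rsym L) of ('I_(rarity r) -> term L n) : formula L n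
| FImp n of formula L n & formula L n : formula L n
| FAll n of formula L n.+1 : formula L n.

Arguments FFalse {L n}.

Definition FNot (L : signature) (n : nat) (p : formula L n) : formula L n :=
  FImp p FFalse.

Definition sentence (L : signature) : Type := formula L 0.

Record structure (L : signature) := Structure {
  carrier :> Type;
  carrier_inhabited : inhabited carrier;
  finterp : forall f : fsym L, ('I_(farity f) -> carrier) -> carrier;
  rinterp : forall r : rsym L, ('I_(rarity r) -> carrier) -> Prop }.

Definition fcons (X : Type) (n : nat) (d : X) (v : 'I_n -> X) : 'I_n.+1 -> X :=
  fun i => if unlift ord0 i is Some j then v j else d.

Definition fcat (X : Type) (n m : nat) (v : 'I_n -> X) (w : 'I_m -> X) :
    'I_(n + m) -> X :=
  fun i => match fintype.split i with inl j => v j | inr j => w j end.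

Fixpoint eval (L : signature) (M : structure L) (n : nat) (v : 'I_n -> M)
    (t : term L n) : M :=
  match t with
  | Var i => v i
  | App f args => finterp (fun i => eval v (args i))
  end.

Fixpoint sat (L : signature) (M : structure L) (n : nat) (p : formula L n) :
    ('I_n -> M) -> Prop :=
  match p in formula _ n return ('I_n -> M) -> Prop with
  | FFalse _ => fun _ => False
  | FEq _ s t => fun v => eval v s = eval v t
  | FRel _ r args => fun v => rinterp (fun i => eval v (args i))
  | FImp _ p q => fun v => sat p v -> sat q v
  | FAll _ p => fun v => forall d : M, sat p (fcons d v)
  end.

Definition holds (L : signature) (M : structure L) (p : sentence L) : Prop :=
  forall v : 'I_0 -> M, sat p v.

Definition models (L : signature) (M : structure L) (T : set (sentence L)) :
    Prop :=
  forall p, T p -> holds M p.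

Definition entails (L : signature) (T : set (sentence L)) (p : sentence L) :
    Prop :=
  forall M : structure L, models M T -> holds M p.

Definition complete_theory (L : signature) (T : set (sentence L)) : Prop :=
  (exists M : structure L, models M T) /\
  (forall p, entails T p \/ entails T (FNot p)).

(** * Formulas with parameters, types, saturation *)

(* A formula p(x_0, ..., x_(n-1); b_0, ..., b_(m-1)) with parameters b_j. *)
Record pformula (L : signature) (M : structure L) (n : nat) := PFormula {
  nparam : nat;
  pform : formula L (n + nparam);
  param : 'I_nparam -> M }.

Arguments param {L M n} p _.

Definition over (L : signature) (M : structure L) (n : nat) (B : set M)
    (p : pformula M n) : Prop :=
  forall j, B (param p j).

Definition psat (L : signature) (M : structure L) (n : nat) (p : pformula M n)
    (x : 'I_n -> M) : Prop :=
  sat (pform p) (fcat x (param p)).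

Definition saturated (L : signature) (M : structure L) : Prop :=
  forall (B : set M) (p : set (pformula M 1)),
    card_lt B [set: M] ->
    (forall phi, p phi -> over B phi) ->
    (forall q : set (pformula M 1), finite_set q -> q `<=` p ->
       exists a : M, forall phi, q phi -> psat phi (fun=> a)) ->
    exists a : M, forall phi, p phi -> psat phi (fun=> a).

Definition big_model (U : Type) (L : signature) (T : set (sentence L))
    (M : structure L) : Prop :=
  models M T /\
  (finite_set [set: M] \/ ([set: M] #= [set: U] /\ saturated M)).

Definition from (M : Type) (n : nat) (A : set M) (a : 'I_n -> M) : Prop :=
  forall i, A (a i).

Definition same_type (L : signature) (M : structure L) (C : set M) (n : nat)
    (a b : 'I_n -> M) : Prop :=
  forall p : pformula M n, over C p -> (psat p a <-> psat p b).

(* The correspondence between the enumerations of [A] and [A'] is given by the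
   values of [f] on [A]. *)
Definition same_type_set (L : signature) (M : structure L) (C A A' : set M) :
    Prop :=
  exists f : M -> M, f @` A = A' /\
    forall (n : nat) (a : 'I_n -> M), from A a -> same_type C a (f \o a).

Definition acl (L : signature) (M : structure L) (B : set M) : set M :=
  [set a | exists p : pformula M 1,
     [/\ over B p, finite_set [set x : M | psat p (fun=> x)]
       & psat p (fun=> a)]].

(** * Ternary relations; [R A C B] reads "A is independent from B over C" *)

Definition trel (M : Type) : Type := set M -> set M -> set M -> Prop.

Definition trel_eq (U M : Type) (R S : trel M) : Prop :=
  forall A C B : set M, small U A -> small U C -> small U B ->
    (R A C B <-> S A C B).

Definition indep_e (L : signature) (M : structure L) : trel M := fun A C B =>
  forall (n : nat) (a : 'I_n -> M), from A a ->
    A `&` acl (range a `|` B `|` C) `<=` acl (range a `|` C).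

Definition indep_a (L : signature) (M : structure L) : trel M := fun A C B =>
  acl (A `|` C) `&` acl (B `|` C) = acl C.

Definition indep_M (U : Type) (L : signature) (M : structure L) : trel M :=
  fun A C B =>
  forall D : set M, small U D -> C `<=` D -> D `<=` acl (B `|` C) ->
    indep_a A D B.

Definition indep_th (U : Type) (L : signature) (M : structure L) : trel M :=
  fun A C B =>
  forall E : set M, small U E -> B `|` C `<=` E ->
    exists A' : set M, same_type_set (B `|` C) A A' /\ indep_M U A' C E.

(* k-inconsistency of the family p(x; b_i), i < omega, refers to k distinct
   indices i, even if some of the tuples b_i coincide. *)
Definition divides (L : signature) (M : structure L) (n : nat) (C : set M)
    (p : pformula M n) : Prop :=
  exists (b : nat -> 'I_(nparam p) -> M) (k : nat),
    (forall i, same_type C (b i) (param p)) /\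
    (forall s : 'I_k -> nat, injective s ->
       ~ exists x : 'I_n -> M, forall j, sat (pform p) (fcat x (b (s j)))).

Definition indep_d (L : signature) (M : structure L) : trel M := fun A C B =>
  ~ exists (n : nat) (a : 'I_n -> M) (p : pformula M n),
      [/\ from A a, over (B `|` C) p, psat p a & divides C p].

Definition local_character (U M : Type) (R : trel M) : Prop :=
  forall A : set M, small U A ->
    exists K : set U, card_lt K [set: U] /\
      forall B : set M, small U B ->
        exists C : set M, [/\ C `<=` B, card_lt C K & R A C B].

Definition small_local_character (U M : Type) (R : trel M) : Prop :=
  forall A B C0 : set M, small U A -> small U B -> small U C0 ->
    C0 `<=` B -> C0 #<= plus_aleph0 A ->
    exists C : set M,
      [/\ C0 `<=` C, C `<=` B, C #<= plus_aleph0 A & R A C B].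

(** * Properties of the theory, evaluated in its big model *)

Definition exchange_property (U : Type) (L : signature) (M : structure L) :
    Prop :=
  forall (a b : M) (C : set M), small U C ->
    acl ([set b] `|` C) a -> ~ acl C a -> acl ([set a] `|` C) b.

Definition real_rosy (U : Type) (L : signature) (M : structure L) : Prop :=
  local_character U (@indep_th U L M).

(* No formula p(x; y) has the order property. *)
Definition stable (L : signature) (M : structure L) : Prop :=
  ~ exists (n m : nat) (p : formula L (n + m))
      (a : nat -> 'I_n -> M) (b : nat -> 'I_m -> M),
      forall i j : nat, sat p (fcat (a i) (b j)) <-> (i < j)%N.

(* Main.v *)
Require Import Defs.
From mathcomp Require Import all_boot.
From mathcomp Require Import boolp classical_sets functions cardinality.

(* Under exchange, acl is a pregeometry and e-independence is symmetric.
   Saturation gives e the extension property, so e implies thorn independence;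
   conversely M-independence, tested on the sets bC for finite tuples b of B,
   gives e with its two sides exchanged.  Small local character comes from the
   supports in B of the elements of A over a basis of A over B.
   If exchange fails for a in acl(bC), then b is e-independent from a over C.
   But b is not thorn-independent from a over C, since a is in acl(bC) and not
   in acl(C); and tp(b/aC) divides over C, since a has infinitely many
   conjugates over C. *)

Set Implicit Arguments.
Unset Strict Implicit.
Unset Printing Implicit Defensive.

Local Open Scope classical_set_scope.
Local Open Scope card_scope.

(** * Tuples *)

(** By definition e-independence concerns only elements of A itself, not of acl(AC), so symmetry and
    the comparison with M-independence need an argument. They rest on one fact,
    [acl_drop_independent]: a point of the closure that creates no algebraic relation among elements
    of A does not need A. In the extension argument the set to be avoided must be smaller than the
    model, so the closure of a small set has to be small; hence the countable signature. The strong
    limit clause of inaccessibility turns the bound |A| + aleph_0 into a strict one. Finite models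
    are treated apart: there acl is always the whole model. *)

Lemma fcons0 (X : Type) n (d : X) (v : 'I_n -> X) : fcons d v ord0 = d.
Proof. by rewrite /fcons unlift_none. Qed.

Lemma fconsS (X : Type) n (d : X) (v : 'I_n -> X) i :
  fcons d v (lift ord0 i) = v i.
Proof. by rewrite /fcons liftK. Qed.

Definition fconsE := (fcons0, fconsS).

Lemma fcat_lshift (X : Type) n m (v : 'I_n -> X) (w : 'I_m -> X) i :
  fcat v w (lshift m i) = v i.
Proof. by rewrite /fcat (unsplitK (inl i)). Qed.

Lemma fcat_rshift (X : Type) n m (v : 'I_n -> X) (w : 'I_m -> X) i :
  fcat v w (rshift n i) = w i.
Proof. by rewrite /fcat (unsplitK (inr i)). Qed.

Definition fcatE := (fcat_lshift, fcat_rshift).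

Lemma fcat_cons (X : Type) m (u : 'I_1 -> X) (w : 'I_m -> X) :
  fcat u w = fcons (u ord0) w.
Proof.
apply/funext => i; case: (split_ordP i) => j ->; rewrite fcatE.
  by rewrite (ord1 j) (_ : lshift m ord0 = ord0) ?fconsE//; exact/val_inj.
by rewrite (_ : rshift 1 j = lift ord0 j) ?fconsE//; exact/val_inj.
Qed.

Lemma fcons_eta (X : Type) n (v : 'I_n.+1 -> X) :
  v = fcons (v ord0) (v \o lift ord0).
Proof.
by apply/funext => i; case: (unliftP ord0 i) => [j|] ->; rewrite fconsE.
Qed.

Lemma comp_fcons (X Y : Type) (f : X -> Y) n (d : X) (v : 'I_n -> X) :
  f \o fcons d v = fcons (f d) (f \o v).
Proof.
by apply/funext => i; case: (unliftP ord0 i) => [j|] -> /=; rewrite !fconsE.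
Qed.

Lemma comp_fcat (X Y : Type) (f : X -> Y) n m (v : 'I_n -> X) (w : 'I_m -> X) :
  f \o fcat v w = fcat (f \o v) (f \o w).
Proof.
by apply/funext => i; case: (split_ordP i) => j -> /=; rewrite !fcatE.
Qed.

Lemma from_fcons (X : Type) n (A : set X) d (v : 'I_n -> X) :
  A d -> from A v -> from A (fcons d v).
Proof.
by move=> Ad Av i; case: (unliftP ord0 i) => [j|] ->; rewrite fconsE.
Qed.

Lemma from_fcat (X : Type) n m (A : set X) (v : 'I_n -> X) (w : 'I_m -> X) :
  from A v -> from A w -> from A (fcat v w).
Proof. by move=> Av Aw i; case: (split_ordP i) => j ->; rewrite fcatE. Qed.

Lemma range_fcons (X : Type) n a (t : 'I_n -> X) :
  range (fcons a t) = [set a] `|` range t.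
Proof.
apply/seteqP; split=> [_ [i _ <-]|x [->|[i _ <-]]].
- case: (unliftP ord0 i) => [j|] ->; rewrite fconsE; last by left.
  by right; exists j.
- by exists ord0; rewrite ?fconsE.
- by exists (lift ord0 i); rewrite ?fconsE.
Qed.

Lemma range_I0 (X : Type) (t : 'I_0 -> X) : range t = set0.
Proof. by apply/seteqP; split=> // x [i]; have := ltn_ord i. Qed.

(** Entries lying in both [P] and [Q] go to the first block; [s] restores the order, so a formula in
    [t] becomes one in [fcat a b] by renaming variables. *)
Lemma split_tuple (X : Type) (P Q : set X) n (t : 'I_n -> X) :
    (forall i, P (t i) \/ Q (t i)) ->
  exists n1 n2 (a : 'I_n1 -> X) (b : 'I_n2 -> X) (s : 'I_n -> 'I_(n1 + n2)),
    [/\ from P a, from Q b & t = fcat a b \o s].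
Proof.
move=> PQ.
pose T1 := {i : 'I_n | `[< P (t i) >]}.
pose T2 := {i : 'I_n | ~~ `[< P (t i) >]}.
exists #|{: T1}|, #|{: T2}|.
exists (fun k => t (val (enum_val k))), (fun k => t (val (enum_val k))).
exists (fun i => match boolP `[< P (t i) >] with
  | AltTrue h => lshift _ (enum_rank (Sub i h : T1))
  | AltFalse h => rshift _ (enum_rank (Sub i h : T2)) end).
split=> [k|k|].
- by apply/asboolP; exact: (valP (enum_val k)).
- by have /asboolPn := valP (enum_val k); case: (PQ (val (enum_val k))).
- by apply/funext => i /=; case: {-}_ / boolP => h; rewrite fcatE enum_rankK.
Qed.

Definition fnil (X : Type) (i : 'I_0) : X :=
  False_rect X (notF (ltn_ord i)).

(** * Definable relations *)

Section Syntax.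
Variable L : signature.

Fixpoint tren n m (s : 'I_n -> 'I_m) (t : term L n) : term L m :=
  match t with
  | Var i => Var L (s i)
  | App f args => App (fun i => tren s (args i))
  end.

Definition ren_lift n m (s : 'I_n -> 'I_m) : 'I_n.+1 -> 'I_m.+1 :=
  fcons ord0 (lift ord0 \o s).

Fixpoint fren n (p : formula L n) : forall m, ('I_n -> 'I_m) -> formula L m :=
  match p in formula _ n return forall m, ('I_n -> 'I_m) -> formula L m with
  | FFalse _ => fun m s => FFalse
  | FEq _ t u => fun m s => FEq (tren s t) (tren s u)
  | FRel _ r args => fun m s => FRel (fun i => tren s (args i))
  | FImp _ p q => fun m s => FImp (fren p s) (fren q s)
  | FAll _ p => fun m s => FAll (fren p (ren_lift s))
  end.

Variable M : structure L.

Lemma eval_tren n m (s : 'I_n -> 'I_m) (t : term L n) (v : 'I_m -> M) :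
  eval v (tren s t) = eval (v \o s) t.
Proof. by elim: t => //= f args IH; congr finterp; apply/funext. Qed.

Lemma sat_fren n (p : formula L n) m (s : 'I_n -> 'I_m) (v : 'I_m -> M) :
  sat (fren p s) v <-> sat p (v \o s).
Proof.
elim: p m s v => {n} [n|n t u|n r args|n p IHp q IHq|n p IH] m s v //=.
- by rewrite !eval_tren.
- rewrite (_ : (fun i => eval v (tren s (args i))) =
    (fun i => eval (v \o s) (args i)))//.
  by apply/funext => i; rewrite eval_tren.
- by split=> H /IHp/H/IHq.
- split=> H d.
    have /IH := H d; rewrite (_ : _ \o _ = fcons d (v \o s))//.
    apply/funext => i; case: (unliftP ord0 i) => [j|] -> /=;
    by rewrite /ren_lift !fconsE//= fconsE.
  apply/IH; rewrite (_ : _ \o _ = fcons d (v \o s))//.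
  apply/funext => i; case: (unliftP ord0 i) => [j|] -> /=;
  by rewrite /ren_lift !fconsE//= fconsE.
Qed.

(** Definability is semantic, so that closure properties replace written-out formulas and variable
    bookkeeping becomes equations between renamed tuples. *)
Definition definable n (P : ('I_n -> M) -> Prop) :=
  exists p : formula L n, forall v, P v <-> sat p v.

Lemma definable_sat n (p : formula L n) : definable (fun v => sat p v).
Proof. by exists p. Qed.

Lemma definable_ext n (P Q : ('I_n -> M) -> Prop) :
  (forall v, P v <-> Q v) -> definable P -> definable Q.
Proof. by move=> PQ [p Pp]; exists p => v; rewrite -PQ Pp. Qed.

Lemma definable_eq n (i j : 'I_n) : definable (fun v => v i = v j).
Proof. by exists (FEq (Var L i) (Var L j)). Qed.

Lemma definable_imp n (P Q : ('I_n -> M) -> Prop) :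
  definable P -> definable Q -> definable (fun v => P v -> Q v).
Proof.
move=> [p Pp] [q Qq]; exists (FImp p q) => v /=.
by split=> H /Pp /H /Qq.
Qed.

Lemma definable_not n (P : ('I_n -> M) -> Prop) :
  definable P -> definable (fun v => ~ P v).
Proof. by move=> [p Pp]; exists (FNot p) => v /=; rewrite Pp. Qed.

Lemma definable_true n : definable (fun _ : 'I_n -> M => True).
Proof. by exists (FNot FFalse) => v /=; split=> // _; exact. Qed.

Lemma definable_and n (P Q : ('I_n -> M) -> Prop) :
  definable P -> definable Q -> definable (fun v => P v /\ Q v).
Proof.
move=> dP dQ; apply: definable_ext
  (definable_not (definable_imp dP (definable_not dQ))) => v.
split=> [H|[Pv Qv] /(_ Pv)]; last exact.
by split; apply: contrapT => N; apply: H => // Pv ?; exact: N.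
Qed.

Lemma definable_ex n (P : ('I_n.+1 -> M) -> Prop) :
  definable P -> definable (fun v => exists d, P (fcons d v)).
Proof.
move=> /definable_not[p Pp].
have : definable (fun v => forall d, ~ P (fcons d v)).
  by exists (FAll p) => v /=; split=> H d; have /Pp := H d.
move=> /definable_not; apply: definable_ext => v.
by split=> [/existsNP[d /contrapT]|[d Pd] /(_ d)]; [exists d|exact].
Qed.

Lemma definable_ren n m (s : 'I_n -> 'I_m) (P : ('I_n -> M) -> Prop) :
  definable P -> definable (fun v => P (v \o s)).
Proof. by move=> [p Pp]; exists (fren p s) => v; rewrite Pp sat_fren. Qed.

End Syntax.

(** Finiteness is not expressed by a formula, but [atleast k] is; a finite solution set is handled
    through some [k] that it does not reach. *)
Definition atleast (X : Type) k (S : set X) :=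
  exists g : 'I_k -> X, injective g /\ forall i, S (g i).

Lemma atleastS (X : Type) k (S : set X) :
  atleast k.+1 S <-> exists y, S y /\ atleast k (S `\ y).
Proof.
split=> [[g [gI Sg]]|[y [Sy [g [gI Sg]]]]].
  exists (g ord0); split=> //; exists (g \o lift ord0); split.
    by move=> i j /gI/lift_inj.
  by move=> i; split=> //= /gI.
exists (fcons y g); split=> [i j|i].
  case: (unliftP ord0 i) => [i'|] ->; case: (unliftP ord0 j) => [j'|] ->;
    rewrite !fconsE//.
  - by move/gI ->.
  - by move=> e; case: (Sg i') => _ /=; rewrite e.
  - by move=> e; case: (Sg j') => _ /=; rewrite -e.
by case: (unliftP ord0 i) => [j|] ->; rewrite fconsE//; case: (Sg j).
Qed.

Lemma infinite_atleast (X : Type) (S : set X) k : infinite_set S -> atleast k S.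
Proof.
elim: k S => [|k IH] S Sinf; first by exists (@fnil _); split=> -[].
have [y Sy] := infinite_setN0 Sinf.
by apply/atleastS; exists y; split=> //; apply/IH/infinite_setD.
Qed.

Lemma finite_atleast (X : Type) (S : set X) :
  finite_set S -> exists k, ~ atleast k S.
Proof.
move=> [n Sn]; exists n.+1 => -[g [gI Sg]].
have : `I_n.+1 #<= `I_n.
  apply: (card_le_trans (B := S)); last by have /card_eqPle[] := Sn.
  have e : `I_n.+1 #= [set: 'I_n.+1] := card_II.
  rewrite (card_le_eql e).
  apply: (card_le_trans (B := range g)).
    by have /card_eqPle[] := @inj_card_eq _ _ [set: 'I_n.+1] g (in2W gI).
  by apply: subset_card_le => _ [i _ <-].
by rewrite card_le_II ltnn.
Qed.

Lemma definable_atleast (L : signature) (M : structure L) k n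
    (P : ('I_n.+1 -> M) -> Prop) :
  definable P -> definable (fun v => atleast k [set x | P (fcons x v)]).
Proof.
elim: k n P => [|k IH] n P dP.
  apply: definable_ext (definable_true M n) => v; split=> // _.
  by exists (@fnil _); split=> -[].
(* For [z = (x, d, v)] this reads [(x, v)]: [P] is asked of the new point [x], without the point [d]
   already removed. *)
pose s : 'I_n.+1 -> 'I_n.+2 := fcons ord0 (lift ord0 \o lift ord0).
have dP' : definable (fun z : 'I_n.+2 -> M =>
    P (z \o s) /\ ~ z ord0 = z (lift ord0 ord0)).
  apply: definable_and; first exact: definable_ren.
  exact/definable_not/definable_eq.
apply: definable_ext (definable_ex (definable_and dP (IH _ _ dP'))) => v.
have E d x : fcons x (fcons d v) \o s = fcons x v.
  rewrite comp_fcons fconsE; congr fcons.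
  by apply/funext => i /=; rewrite !fconsE.
rewrite atleastS; split=> -[y [Py H]]; exists y; split=> //;
  move: H; congr atleast; apply/funext => x /=; rewrite E !fconsE;
  exact: propext.
Qed.

(** * Algebraic closure *)

Section AlgebraicClosure.
Variables (L : signature) (M : structure L).
Implicit Types (A B C D : set M) (a b x : M).

Lemma aclP B a : acl B a <->
  exists m (P : ('I_m.+1 -> M) -> Prop) (b : 'I_m -> M),
    [/\ definable P, from B b, finite_set [set x | P (fcons x b)]
      & P (fcons a b)].
Proof.
split=> [[[m p b] [/= Bb fin pa]]|[m [P [b [[p pP] Bb fin Pa]]]]].
  exists m, (sat p), b; split=> //; first exact: definable_sat.
    apply: sub_finite_set fin => x /=; rewrite /psat /= fcat_cons//.
  by move: pa; rewrite /psat /= fcat_cons.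
exists (@PFormula L M 1 m p b); split=> //.
  by apply: sub_finite_set fin => x; rewrite /psat /= fcat_cons => /pP.
by rewrite /psat /= fcat_cons; apply/pP.
Qed.

Lemma acl_mono A B : A `<=` B -> acl A `<=` acl B.
Proof. by move=> AB a [p [Ap *]]; exists p; split=> // j; exact/AB/Ap. Qed.

Lemma sub_acl A : A `<=` acl A.
Proof.
move=> a Aa; apply/aclP; exists 1, (fun z => z ord0 = z (lift ord0 ord0)).
exists (fun=> a); split=> //; first exact: definable_eq.
  rewrite (_ : mkset _ = [set a]) ?finite_set1//.
  by apply/seteqP; split=> x /=; rewrite !fconsE.
by rewrite !fconsE.
Qed.

Lemma acl1P C s a : acl ([set s] `|` C) a ->
  exists m (P : ('I_m.+2 -> M) -> Prop) (c : 'I_m -> M),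
    [/\ definable P, from C c, finite_set [set x | P (fcons x (fcons s c))]
      & P (fcons a (fcons s c))].
Proof.
move=> /aclP[n [P [t [dP Ct fin Pa]]]].
have [n1 [n2 [u [c [r [us Cc tE]]]]]] := split_tuple Ct.
(* All occurrences of [s] among the parameters are identified with the one variable x_1. *)
pose r' : 'I_n.+1 -> 'I_n2.+2 := fcons ord0 (fun i =>
  match fintype.split (r i) with
  | inl _ => lift ord0 ord0
  | inr j => lift ord0 (lift ord0 j) end).
have E x : fcons x (fcons s c) \o r' = fcons x t.
  rewrite comp_fcons fconsE tE; congr fcons; apply/funext => i /=.
  rewrite /fcat; case: fintype.split => j; rewrite !fconsE//.
  by rewrite us.
exists n2, (fun z => P (z \o r')), c; split=> //; first exact: definable_ren.
  by apply: sub_finite_set fin => x /=; rewrite E.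
by rewrite E.
Qed.

Lemma acl1_trans C s a : acl ([set s] `|` C) a -> acl C s -> acl C a.
Proof.
move=> /acl1P[m [P [c [dP Cc fin Pa]]]] /aclP[n [Q [d [dQ Cd finQ Qs]]]].
have [k Nk] := finite_atleast fin.
pose inl' : 'I_m.+2 -> 'I_(m + n).+2 :=
  fcons (lift ord0 ord0)
    (fcons ord0 (fun i => lift ord0 (lift ord0 (lshift n i)))).
pose inl'' : 'I_m.+2 -> 'I_(m + n).+3 :=
  fcons ord0 (fcons (lift ord0 ord0)
    (fun i => lift ord0 (lift ord0 (lift ord0 (lshift n i))))).
pose inr' : 'I_n.+1 -> 'I_(m + n).+2 :=
  fcons ord0 (fun i => lift ord0 (lift ord0 (rshift m i))).
have El y x : fcons y (fcons x (fcat c d)) \o inl' = fcons x (fcons y c).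
  rewrite !comp_fcons !fconsE; do 2!congr fcons.
  by apply/funext => i /=; rewrite !fconsE fcatE.
have El' z y x :
    fcons z (fcons y (fcons x (fcat c d))) \o inl'' = fcons z (fcons y c).
  rewrite !comp_fcons !fconsE; do 2!congr fcons.
  by apply/funext => i /=; rewrite !fconsE fcatE.
have Er y x : fcons y (fcons x (fcat c d)) \o inr' = fcons y d.
  rewrite comp_fcons !fconsE; congr fcons.
  by apply/funext => i /=; rewrite !fconsE fcatE.
(* The last clause discards every [y] whose fibre has [k] or more points: only the fibre at [s] is
   known to be finite, and other roots of [Q] could have infinite ones. A finite union of finite
   fibres remains. *)
pose R (z : 'I_(m + n).+2 -> M) := Q (z \o inr') /\ (P (z \o inl') /\
  ~ atleast k [set x | P (fcons x z \o inl'')]).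
have dR : definable R.
  apply: definable_and; first exact: definable_ren.
  apply: definable_and; first exact: definable_ren.
  apply: definable_not.
  exact: (definable_atleast k (definable_ren inl'' dP)).
have RE y x : R (fcons y (fcons x (fcat c d))) =
    (Q (fcons y d) /\ (P (fcons x (fcons y c)) /\
     ~ atleast k [set z | P (fcons z (fcons y c))])).
  rewrite /R El Er; congr (_ /\ (_ /\ ~ atleast k _)).
  by apply/funext => z /=; rewrite El'.
apply/aclP; exists (m + n), (fun v => exists y, R (fcons y v)), (fcat c d).
split; first exact: definable_ex.
- exact: from_fcat.
- have := @bigcup_finite _ _ [set y | Q (fcons y d)]
    (fun y => [set x | P (fcons x (fcons y c)) /\
      ~ atleast k [set z | P (fcons z (fcons y c))]]) finQ.
  move=> H; apply: sub_finite_set (H _) => [x [y]|y Qy].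
    by rewrite RE => -[Qy Py]; exists y.
  have [f|inf] := pselect (finite_set [set z | P (fcons z (fcons y c))]).
    by apply: sub_finite_set f => x [].
  rewrite (_ : mkset _ = set0)//; apply/seteqP; split=> // x /= [_].
  by apply; exact: infinite_atleast.
- by exists s; rewrite RE.
Qed.

Lemma acl_finite_char A D x : acl (A `|` D) x ->
  exists n (a : 'I_n -> M), from A a /\ acl (range a `|` D) x.
Proof.
move=> /aclP[n [P [t [dP ADt fin Px]]]].
have [n1 [n2 [u [c [r [uA Dc tE]]]]]] := split_tuple ADt.
exists n1, u; split=> //; apply/aclP; exists n, P, t; split=> // i.
rewrite tE /=; case: (split_ordP (r i)) => j ->; rewrite fcatE.
  by left; exists j.
by right.
Qed.

Lemma acl_sub_trans A B : A `<=` acl B -> acl A `<=` acl B.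
Proof.
move=> AB x; rewrite -[A]setU0 => /acl_finite_char[n [t [At tx]]].
have {tx} : acl (range t `|` B) x by apply: acl_mono tx; apply: setUS.
elim: n t At => [|n IH] t At; first by rewrite range_I0 set0U.
rewrite (fcons_eta t) range_fcons -setUA => H.
apply: (IH (t \o lift ord0)) => [i|]; first exact: At.
apply: acl1_trans H _; apply: acl_mono (AB _ (At ord0)).
exact: subsetUr.
Qed.

Lemma acl_finite B : finite_set [set: M] -> acl B = setT.
Proof.
move=> fM; apply/seteqP; split=> // x _; apply/aclP.
exists 0, (fun=> True), (@fnil _).
split; [exact: definable_true|by case|exact: sub_finite_set fM|by []].
Qed.
End AlgebraicClosure.

(** * Cardinality *)

Lemma set_inj_card_le (X Y : Type) (A : set X) (B : set Y) (f : X -> Y) :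
  (forall x, A x -> B (f x)) ->
  (forall x y, A x -> A y -> f x = f y -> x = y) -> A #<= B.
Proof.
move=> fAB finj.
have /injfunPex[g] : exists2 f : X -> Y, set_fun A B f & set_inj A f.
  by exists f => // x y /set_mem Ax /set_mem Ay; exact: finj.
exact: inj_card_le g.
Qed.

Lemma card_le_set_inj (X Y : Type) (y0 : Y) (A : set X) (B : set Y) :
  A #<= B -> exists f : X -> Y, (forall x, A x -> B (f x)) /\
    (forall x y, A x -> A y -> f x = f y -> x = y).
Proof.
elim/Ppointed: Y => Y in y0 B *; first by case: (no y0).
move=> /pcard_leP/injfunPex[f fAB finj]; exists f; split=> // x y Ax Ay.
by apply: finj; exact/mem_set.
Qed.

(* A maximal family [F] of disjoint injective sequences covers [A] up to a
   finite set, so that [A] is [F * nat] up to a finite set. *)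
Lemma card_leXnat (X : Type) (A : set X) :
  infinite_set A -> A `*` [set: nat] #<= A.
Proof.
move=> Ainf; have [x0 Ax0] := infinite_setN0 Ainf.
pose P (F : set (nat -> X)) :=
  (forall g, F g -> injective g /\ forall i, A (g i)) /\
  (forall g h i j, F g -> F h -> g i = h j -> g = h).
have [|F [[FA Fdis] Fmax]] := @Zorn_bigcup _ P.
  move=> G GP Gtot; split=> [g [F GF Fg]|g h i j [F GF Fg] [F' GF' F'h]].
    exact: (GP F GF).1.
  have [FF'|F'F] := Gtot _ _ GF GF'.
    by apply: (GP F' GF').2 => //; exact: FF'.
  by apply: (GP F GF).2 => //; exact: F'F.
pose R := [set x | A x /\ forall g i, F g -> x <> g i].
have Rfin : finite_set R.
  apply: contrapT => /infiniteP/(card_le_set_inj x0)[g [Rg ginj]].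
  apply: (Fmax (g |` F)).
    split=> [h Fh|/(_ g (or_introl erefl)) Fg]; first by right.
    by have [_ /(_ g 0%N Fg)] := Rg 0%N I.
  split=> [h [->|]|h h' i j]; last 1 first.
  - case=> [->|Fh] [->|Fh'] //; last exact: Fdis.
      by move=> e; case: (Rg i I) => _ /(_ h' j Fh').
    by move=> e; case: (Rg j I) => _ /(_ h i Fh)[].
  - split=> [i j|i]; first exact: ginj.
    by case: (Rg i I).
  - exact: FA.
have [g0 Fg0] : exists g0, F g0.
  apply: contrapT => /forallNP F0; apply: Ainf.
  apply: sub_finite_set Rfin => x Ax.
  by split=> // g i /F0.
have /countable_injP[r rinj] := finite_set_countable Rfin.
have /choice[k kP] : forall a, exists gs : (nat -> X) * (nat + nat), A a ->
    F gs.1 /\ match gs.2 with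
              | inl i => a = gs.1 i
              | inr n => R a /\ n = r a end.
  move=> a; have [Ra|NRa] := pselect (R a).
    by exists (g0, inr (r a)).
  have [Aa|NAa] := pselect (A a); last by exists (g0, inl 0%N).
  have : exists g i, F g /\ a = g i.
    apply: contrapT => H; apply: NRa; split=> // g i Fg ai.
    by apply: H; exists g, i.
  by move=> [g [i [Fg ai]]]; exists (g, inl i).
(* The copy [(a, n)] goes to the sequence attached to [a] (to [g0] if [a] is in [R]), at the
   position coding [n] and the address of [a]. *)
apply: (@set_inj_card_le _ _ _ _
  (fun an => (k an.1).1 (choice.pickle ((k an.1).2, an.2)))).
  by move=> [a n] [/= Aa _]; apply: (FA _ (kP _ Aa).1).2.
move=> [a n] [b m] [/= Aa _] [/= Ab _] e.
have [Fa Ha] := kP a Aa; have [Fb Hb] := kP b Ab.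
have ge := Fdis _ _ _ _ Fa Fb e; move: e; rewrite ge => /(FA _ Fb).1.
move=> /(pcan_inj choice.pickleK)[se ->].
move: Ha Hb; rewrite se ge; case: (k b).2 => [i ai bi|l [Ra la] [Rb lb]].
  by rewrite ai -bi.
by congr pair; apply: rinj; rewrite ?inE// -la -lb.
Qed.

Lemma card_le_bigcup_countable (X Y Z : Type) (Q : set Z) (A : set X)
    (C0 : set Y) (S : X -> set Y) :
  infinite_set Q -> C0 #<= Q -> A #<= Q ->
  (forall a, A a -> countable (S a)) -> C0 `|` \bigcup_(a in A) S a #<= Q.
Proof.
move=> Qinf C0Q AQ Scount; have [z0 Qz0] := infinite_setN0 Qinf.
apply: card_le_trans (card_leXnat Qinf).
have [g [gQ ginj]] := card_le_set_inj z0 C0Q.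
have [h [hQ hinj]] := card_le_set_inj z0 AQ.
have /choice[e eP] : forall a, exists e : Y -> nat, A a ->
    {in S a &, injective e}.
  move=> a; have [Aa|NAa] := pselect (A a); last by exists (fun=> 0%N).
  by have /countable_injP[e eP] := Scount _ Aa; exists e.
(* Second coordinate 0 is reserved for [C0]; the successor keeps the sets [S a] apart from it. *)
have /choice[k kP] : forall c, exists zn : Z * nat,
    (C0 `|` \bigcup_(a in A) S a) c ->
    (C0 c /\ zn = (g c, 0%N)) \/
    (exists a, [/\ A a, S a c & zn = (h a, (e a c).+1)]).
  move=> c; have [C0c|NC0c] := pselect (C0 c).
    by exists (g c, 0%N) => _; left.
  have [[a Aa Sac]|N] := pselect ((\bigcup_(a in A) S a) c).
    by exists (h a, (e a c).+1) => _; right; exists a.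
  by exists (z0, 0%N) => -[].
apply: (@set_inj_card_le _ _ _ _ k) => [c /kP[[Cc ->]|[a [Aa _ ->]]]|c d].
- by split=> //=; exact: gQ.
- by split=> //=; exact: hQ.
move=> /kP[[Cc ->]|[a [Aa Sac ->]]] /kP[[Cd ->]|[b [Ab Sbd ->]]] //.
  by move=> [/ginj]; exact.
move=> [/hinj-/(_ Aa Ab) ab]; move: Sac; rewrite ab => Sac.
by apply: (eP _ Ab); exact/mem_set.
Qed.

Lemma infinite_plus_aleph0 (X : Type) (A : set X) :
  infinite_set (plus_aleph0 A).
Proof.
by apply/infiniteP; apply: (@set_inj_card_le _ _ _ _ inr) => // m n _ _ [].
Qed.

Lemma card_le_plus_aleph0 (X : Type) (A : set X) : A #<= plus_aleph0 A.
Proof. by apply: (@set_inj_card_le _ _ _ _ inl) => // m n _ _ []. Qed.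

Section Small.
Variables (U : Type) (HU : inaccessible U).

Lemma inaccessible_nat_le : [set: nat] #<= [set: U].
Proof.
by case: HU => ncU _ _; apply/infiniteP => /finite_set_countable.
Qed.

Lemma inaccessible_inhabited : inhabited U.
Proof.
have /infiniteP/infinite_setN0[u _] := inaccessible_nat_le.
by exists.
Qed.

Lemma small_le (X Y : Type) (A : set X) (B : set Y) :
  A #<= B -> small U B -> small U A.
Proof.
move=> AB [BU NUB]; split; first exact: card_le_trans BU.
by move=> UA; apply: NUB; exact: card_le_trans AB.
Qed.

Lemma small_sub (X : Type) (A B : set X) : A `<=` B -> small U B -> small U A.
Proof. by move=> /subset_card_le; exact: small_le. Qed.

Lemma small_countable (X : Type) (A : set X) : countable A -> small U A.
Proof.
case: HU => ncU _ _ cA; split; first exact: card_le_trans inaccessible_nat_le.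
by move=> UA; apply: ncU; exact: card_le_trans cA.
Qed.

Lemma small_set1 (X : Type) (x : X) : small U [set x].
Proof. exact/small_countable/finite_set_countable/finite_set1. Qed.

Lemma small_card_lt (X : Type) (A : set X) :
  [set: X] #= [set: U] -> small U A -> card_lt A [set: X].
Proof.
move=> XU [AU NUA].
by split; rewrite ?(card_le_eqr XU)// (card_le_eql XU).
Qed.

(** Regularity is stated for subsets of [U], so the members and the index set are first copied into
    [U]. *)
Lemma small_bigcup (X Y : Type) (I : set X) (F : X -> set Y) :
  [set: Y] #<= [set: U] -> small U I -> (forall i, I i -> small U (F i)) ->
  small U (\bigcup_(i in I) F i).
Proof.
move=> YU sI sF; have [u0] := inaccessible_inhabited.
have [e [_ einj]] := card_le_set_inj u0 YU.
have [j [_ jinj]] := card_le_set_inj u0 sI.1.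
have eeq (A : set Y) : e @` A #= A.
  by apply: inj_card_eq => x y _ _; exact: einj.
(* By injectivity of [j] this union has at most one member; it avoids choosing an inverse of [j]. *)
pose F' u := \bigcup_(i in [set i | I i /\ j i = u]) (e @` F i).
have sF' : small U (\bigcup_(u in j @` I) F' u).
  case: HU => _ + _; apply; first exact: small_le (card_image_le _ _) sI.
  move=> _ [i Ii <-]; apply: small_le (sF _ Ii).
  apply: card_le_trans (card_image_le e _); apply: subset_card_le.
  by move=> u [i' [Ii' /jinj ->//]].
apply: small_le sF'; rewrite -(card_le_eql (eeq _)); apply: subset_card_le.
move=> _ [y [i Ii Fiy] <-]; exists (j i); first by exists i.
by exists i => //; exists y.
Qed.

Lemma small_setU (X : Type) (A B : set X) :
  [set: X] #<= [set: U] -> small U A -> small U B -> small U (A `|` B).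
Proof.
move=> XU sA sB.
have : small U (\bigcup_(b in [set: bool]) (if b then A else B)).
  by apply: small_bigcup => // [|[]]//; exact/small_countable.
by apply: small_sub => x [Ax|Bx]; [exists true|exists false].
Qed.

Lemma small_bigcup_tuples (Y : Type) (B : set Y) n (F : ('I_n -> Y) -> set Y) :
  [set: Y] #<= [set: U] -> small U B -> (forall b, small U (F b)) ->
  small U (\bigcup_(b in from B (n := n)) F b).
Proof.
move=> YU sB; elim: n F => [|n IH] F sF.
  apply: small_sub (sF (@fnil _)) => x [b _ Fb].
  by rewrite (_ : fnil _ = b)//; apply/funext => -[].
have : small U (\bigcup_(y in B) \bigcup_(b in from B (n := n)) F (fcons y b)).
  by apply: small_bigcup => // y _; exact: IH.
apply: small_sub => x [b Bb Fb]; exists (b ord0); first exact: Bb.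
exists (b \o lift ord0); first by move=> i; exact: Bb.
by rewrite -fcons_eta.
Qed.

(** Local character wants a strict bound. The power set of a set of cardinality |A| + aleph_0
    exceeds it by Cantor, and stays below upsilon, a strong limit. *)
Lemma small_lt_card (X : Type) (A : set X) : small U A ->
  exists K : set U, card_lt K [set: U] /\
    forall (Y : Type) (C : set Y), C #<= plus_aleph0 A -> card_lt C K.
Proof.
move=> sA; have [u0] := inaccessible_inhabited.
have [e [_ einj]] := card_le_set_inj u0 sA.1.
have [d [_ dinj]] := card_le_set_inj u0 inaccessible_nat_le.
pose K0 := e @` A `|` range d.
have sK0 : small U K0.
  apply: small_setU => //; first exact: small_le (card_image_le _ _) sA.
  by apply: small_countable; exact: card_image_le.
have K0inf : infinite_set K0.
  apply/infiniteP.
  apply: (@set_inj_card_le _ _ _ _ d) => [n _|m n _ _ /dinj->//].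
  by right; exists n.
have AK0 : plus_aleph0 A #<= K0.
  apply: card_le_trans (card_leXnat K0inf).
  apply: (@set_inj_card_le _ _ _ _ (fun x => match x with
    | inl a => (e a, 0%N)
    | inr n => (d 0%N, n.+1) end)) => [[a|n]|[a|n] [b|m]] //=.
  - by move=> Aa; split=> //; left; exists a.
  - by move=> _; split=> //; right; exists 0%N.
  - by move=> Aa Ab [/einj->].
  - by move=> _ _ [->].
case: HU => _ _ /(_ _ sK0) sP.
have [h [_ hinj]] := card_le_set_inj u0 sP.1.
exists (h @` [set X : set U | X `<=` K0]).
split; first exact: small_le (card_image_le _ _) sP.
have PK : h @` [set X : set U | X `<=` K0] #= [set X : set U | X `<=` K0].
  by apply: inj_card_eq => V W /set_mem HV /set_mem HW; exact: hinj.
move=> Y C CA; split.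
  rewrite (card_le_eqr PK); apply: card_le_trans (card_le_trans CA AK0) _.
  apply: (@set_inj_card_le _ _ _ _ (fun u => [set u])).
    by move=> u K0u _ ->.
  move=> u v _ _.
  by move=> /seteqP[/(_ u erefl)].
rewrite (card_le_eql PK) => PC.
have [f [fK0 finj]] :=
  card_le_set_inj u0 (card_le_trans PC (card_le_trans CA AK0)).
(* Cantor's diagonal set: [f] would inject the subsets of [K0] into [K0]. *)
pose D := [set f V | V in [set V | V `<=` K0 /\ ~ V (f V)]].
have DK0 : D `<=` K0 by move=> _ [V [VK0 _] <-]; exact: fK0.
have [Df|NDf] := pselect (D (f D)).
  have [V [VK0 NV] fVD] := Df; have VD := finj _ _ VK0 DK0 fVD.
  by apply: NV; rewrite VD.
by apply: (NDf); exists D.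
Qed.

End Small.

Section CountableSyntax.
Variables (L : signature) (HL : countable_signature L).

Lemma countable_formula n : countable [set: formula L n].
Proof.
case: HL => /countable_injP[cf cfI] /countable_injP[cr crI].
have {}cfI : injective cf by move=> x y; apply: cfI; rewrite inE.
have {}crI : injective cr by move=> x y; apply: crI; rewrite inE.
have mapI (T : Type) k (f : T -> choice.GenTree.tree nat) (g h : 'I_k -> T) :
    (forall i y, f (g i) = f y -> g i = y) ->
    [seq f (g i) | i <- enum 'I_k] = [seq f (h i) | i <- enum 'I_k] -> g = h.
  by move=> gI /eq_in_map e; apply/funext => i; apply: gI; rewrite e ?mem_enum.
pose tcode := fix tcode n (t : term L n) : choice.GenTree.tree nat :=
  match t with
  | Var i => choice.GenTree.Leaf (i : nat)
  | App f args =>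
    choice.GenTree.Node (cf f) [seq tcode n (args i) | i <- enum 'I_(farity f)]
  end.
have tcodeI k : forall t u : term L k, tcode k t = tcode k u -> t = u.
  elim=> [i|f args IH] [j|g args'] //= => [[/val_inj->]//|[/cfI fg]].
  by move: args'; rewrite -fg => args' /mapI ->.
(* Labels 0 to 3 mark the logical constructors, hence the shift by 4 for relation symbols. *)
pose fcode := fix fcode n (p : formula L n) : choice.GenTree.tree nat :=
  match p with
  | FFalse _ => choice.GenTree.Node 0 [::]
  | FEq _ t u => choice.GenTree.Node 1 [:: tcode _ t; tcode _ u]
  | FRel _ r args => choice.GenTree.Node (cr r).+4
      [seq tcode _ (args i) | i <- enum 'I_(rarity r)]
  | FImp _ p q => choice.GenTree.Node 2 [:: fcode _ p; fcode _ q]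
  | FAll _ p => choice.GenTree.Node 3 [:: fcode _ p]
  end.
have fcodeI k (p : formula L k) : forall q, fcode k p = fcode k q -> p = q.
  elim: p => {k} [k|k t u|k r args|k p IHp q IHq|k p IHp] q';
    destruct q' => //=.
  - by move=> [/tcodeI-> /tcodeI->].
  - case=> /crI rr; move: r0 rr t => r0 <- t /mapI -> // i y; exact: tcodeI.
  - by move=> [/IHp-> /IHq->].
  - by move=> [/IHp->].
apply: card_le_trans (countableP [set: choice.GenTree.tree nat]).
by apply: (@set_inj_card_le _ _ _ _ (fcode n)) => // p q _ _; exact: fcodeI.
Qed.

Variables (U : Type) (HU : inaccessible U) (M : structure L).

Lemma small_acl (B : set M) :
  [set: M] #<= [set: U] -> small U B -> small U (acl B).
Proof.
move=> MU sB.
(* Finiteness is part of [F], so that each of its values is finite whatever [p] and [b] are. *)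
pose F n (p : formula L (1 + n)) (b : 'I_n -> M) :=
  [set x | sat p (fcons x b) /\ finite_set [set x | sat p (fcons x b)]].
have : small U (\bigcup_(n in [set: nat])
    \bigcup_(p in [set: formula L (1 + n)])
    \bigcup_(b in from B (n := n)) F n p b).
  apply: small_bigcup => // [|n _]; first exact: small_countable.
  apply: small_bigcup => // [|p _].
    exact/small_countable/countable_formula.
  apply: small_bigcup_tuples => // b; apply: small_countable => //.
  apply: finite_set_countable.
  have [f|inf] := pselect (finite_set [set x | sat p (fcons x b)]).
    by apply: sub_finite_set f => x [].
  by rewrite (_ : F _ _ _ = set0)//; apply/seteqP; split=> // x [].
apply: small_sub => a [[n p b] [/= Bb fin pa]].
exists n => //; exists p => //; exists b => //.
split; first by move: pa; rewrite /psat /= fcat_cons.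
by apply: sub_finite_set fin => x; rewrite /psat /= fcat_cons.
Qed.

End CountableSyntax.

(** * Elementary maps, as graphs *)

Section Elementary.
Variables (L : signature) (M : structure L).
Implicit Types (G : set (M * M)) (N S : set M).

(** With graphs, inverses and unions of chains are plain set operations. As equality is a formula,
    such a graph is automatically functional and injective. *)
Definition elementary G :=
  forall n (p : formula L n) (a b : 'I_n -> M),
    (forall i, G (a i, b i)) -> (sat p a <-> sat p b).

Lemma elementary_definable G n (P : ('I_n -> M) -> Prop) (a b : 'I_n -> M) :
  elementary G -> definable P -> (forall i, G (a i, b i)) -> P a <-> P b.
Proof. by move=> eG [p Pp] Gab; rewrite !Pp; exact: eG. Qed.

Lemma elementary_inv G : elementary G -> elementary [set xy | G (xy.2, xy.1)].
Proof. by move=> eG n p a b /= Gab; apply: iff_sym; exact: eG. Qed.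

Lemma elementary_id S : elementary [set xy | S xy.1 /\ xy.2 = xy.1].
Proof.
move=> n p a b Sab; rewrite (_ : b = a)//.
by apply/funext => i; case: (Sab i).
Qed.

Lemma elementary_fun G x y z : elementary G -> G (x, y) -> G (x, z) -> y = z.
Proof.
move=> eG Gxy Gxz.
have dE := definable_eq M (ord0 : 'I_2) (lift ord0 ord0).
have := elementary_definable (a := fcons x (fcons x (@fnil _)))
  (b := fcons y (fcons z (@fnil _))) eG dE.
rewrite !fconsE => H; apply: (H _).1 => // i.
case: (unliftP ord0 i) => [j|] ->; rewrite !fconsE//.
by rewrite (ord1 j) !fconsE.
Qed.

(** A bound on the number of solutions is itself a formula, so it passes along [G] too. *)
Lemma elementary_acl G S S' x y :
    elementary G -> G (x, y) ->
    (forall s, S s -> exists2 s', S' s' & G (s, s')) ->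
  acl S x -> acl S' y.
Proof.
move=> eG Gxy SS' /aclP[m [P [t [dP St fin Px]]]].
have /choice[t' Gt] : forall i, exists s', S' s' /\ G (t i, s').
  by move=> i; have [s'] := SS' _ (St i); exists s'.
apply/aclP; exists m, P, t'; split=> //; first by move=> i; case: (Gt i).
  have [k Nk] := finite_atleast fin.
  apply: contrapT => /(infinite_atleast k); apply: contra_not Nk.
  apply: (elementary_definable eG (definable_atleast k dP) _).2.
  by move=> i; case: (Gt i).
apply: (elementary_definable eG dP _).1 Px => i.
by case: (unliftP ord0 i) => [j|] ->; rewrite !fconsE//; case: (Gt j).
Qed.

Lemma elementary_same_type (C A : set M) (f : M -> M) :
    (forall n (a : 'I_n -> M), from A a -> same_type C a (f \o a)) ->
  elementary ([set xy | A xy.1 /\ xy.2 = f xy.1] `|`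
              [set xy | C xy.1 /\ xy.2 = xy.1]).
Proof.
move=> st n p a b Gab.
have [n1 [n2 [u [w [r [uf wC abE]]]]]] :=
  split_tuple (t := fun i => (a i, b i)) Gab.
have -> : a = fcat (fst \o u) (fst \o w) \o r.
  by rewrite -comp_fcat -compA -abE.
have -> : b = fcat (f \o (fst \o u)) (fst \o w) \o r.
  have -> : f \o (fst \o u) = snd \o u.
    by apply/funext => i; case: (uf i) => _ /= ->.
  have -> : fst \o w = snd \o w.
    by apply/funext => i; case: (wC i) => _ /= ->.
  by rewrite -comp_fcat -compA -abE.
have := @st _ (fst \o u) (fun i => (uf i).1)
  (@PFormula L M n1 n2 (fren p r) (fst \o w)) (fun i => (wC i).1).
by rewrite /psat /= !sat_fren.
Qed.

Lemma same_type_elementary G (C A : set M) (f : M -> M) :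
    elementary G -> (forall c, C c -> G (c, c)) ->
    (forall x, A x -> G (x, f x)) ->
  forall n (a : 'I_n -> M), from A a -> same_type C a (f \o a).
Proof.
move=> eG GC Gf n a Aa p Cp; apply: eG => i.
by case: (split_ordP i) => j ->; rewrite !fcatE; [exact: Gf|exact: GC].
Qed.

Lemma finite_set_range (T : Type) (q : set T) :
  finite_set q -> exists n (f : 'I_n -> T), q = range f.
Proof.
elim/Peq: T => T in q *; move=> /finite_seqP[s ->].
exists (size s), (tnth (in_tuple s)); apply/seteqP; split=> [x|_ [i _ <-]].
  by move=> /(tnthP (in_tuple s))[i ->]; exists i.
exact: mem_tnth.
Qed.

(** The image under [G] of the type of [a] over the domain of [G], together with x <> n for [n] in
    [N]. *)
Let in_type G N (a : M) (phi : pformula M 1) :=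
  (exists2 u, (forall j, G (u j, param phi j)) & sat (pform phi) (fcons a u)) \/
  (exists2 n, N n & forall x, psat phi (fun=> x) <-> x <> n).

(** Finitely many conditions amount to one formula, carried from [u] to [v], and finitely many
    points to avoid. *)
Let in_type_finite G N a k (s : 'I_k -> pformula M 1) :
    (forall i, in_type G N a (s i)) ->
  exists m (P : ('I_m.+1 -> M) -> Prop) (u v : 'I_m -> M) (F : set M),
    [/\ definable P, (forall i, G (u i, v i)), P (fcons a u),
        finite_set F /\ F `<=` N
      & forall x, P (fcons x v) -> ~ F x ->
        forall i, psat (s i) (fun=> x)].
Proof.
elim: k s => [|k IH] s st.
  exists 0, (fun=> True), (@fnil _), (@fnil _), set0.
  split; [exact: definable_true|by case|by []| |by move=> x _ _ []].
  by split; [|exact: sub0set].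
have [i|m [P [u [v [F [dP Guv Pu [fF FN] PF]]]]]] := IH (s \o lift ord0).
  exact: st.
have [[w Gw phiw]|[n Nn phin]] := st ord0; last first.
  exists m, P, u, v, (n |` F); split=> //.
    split; last by move=> x [->|/FN].
    by rewrite finite_setU; split=> //; exact: finite_set1.
  move=> x Px NFx i; case: (unliftP ord0 i) => [j|] ->.
    by apply: (PF x Px _ j) => Fx; apply: NFx; right.
  by apply/phin => xn; apply: NFx; left.
set phi := s ord0 in Gw phiw.
pose r1 : 'I_(1 + nparam phi) -> 'I_(nparam phi + m).+1 :=
  fcons ord0 (lift ord0 \o lshift m).
pose r2 : 'I_m.+1 -> 'I_(nparam phi + m).+1 :=
  fcons ord0 (lift ord0 \o @rshift (nparam phi) m).
have E1 x (y : 'I_(nparam phi) -> M) z : fcons x (fcat y z) \o r1 = fcons x y.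
  rewrite comp_fcons fconsE; congr fcons.
  by apply/funext => i /=; rewrite !fconsE fcatE.
have E2 x (y : 'I_(nparam phi) -> M) z : fcons x (fcat y z) \o r2 = fcons x z.
  rewrite comp_fcons fconsE; congr fcons.
  by apply/funext => i /=; rewrite !fconsE fcatE.
exists (nparam phi + m), (fun z => sat (pform phi) (z \o r1) /\ P (z \o r2)).
exists (fcat w u), (fcat (param phi) v), F; split=> //.
- by apply: definable_and; apply: definable_ren => //; exact: definable_sat.
- by move=> i; case: (split_ordP i) => j ->; rewrite !fcatE.
- by rewrite E1 E2.
- move=> x; rewrite E1 E2 => -[phix Px] NFx i.
  case: (unliftP ord0 i) => [j|] ->; first exact: PF.
  by rewrite /psat fcat_cons.
Qed.

(* A non-algebraic type has a realization outside any set of fewer than |M|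
   elements: each of its formulas has infinitely many solutions. *)
Lemma elementary_extend G N a :
    saturated M -> elementary G -> card_lt (snd @` G `|` N) [set: M] ->
    N = set0 \/ ~ acl (fst @` G) a ->
  exists b, ~ N b /\ elementary ((a, b) |` G).
Proof.
move=> Msat eG small_GN Na.
pose tp := [set phi : pformula M 1 |
  Defs.over (snd @` G `|` N) phi /\ in_type G N a phi].
have [|q qfin qp|b bp] := Msat _ tp small_GN.
- by move=> phi [].
- have [k [s qE]] := finite_set_range qfin.
  have [i|m [P [u [v [F [dP Guv Pu [fF FN] PF]]]]]] :=
      @in_type_finite G N a k s.
    by have [] : tp (s i) by apply: qp; rewrite qE; exists i.
  suff [x Px NFx] : exists2 x, P (fcons x v) & ~ F x.
    by exists x => phi; rewrite qE => -[i _ <-]; exact: PF.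
  (* With nothing to avoid, solvability suffices; otherwise infinitely many solutions are needed,
     and this passes from [u] to [v] one bound [l] at a time. *)
  case: Na => [N0|Na].
    have /(elementary_definable eG (definable_ex dP) Guv)[x Px] :
      exists x, P (fcons x u) by exists a.
    by exists x => // /FN; rewrite N0.
  have Puinf : infinite_set [set x | P (fcons x u)].
    move=> fin; apply: Na; apply/aclP; exists m, P, u; split=> // i.
    by exists (u i, v i).
  have Pvinf : infinite_set [set x | P (fcons x v)].
    move=> /finite_atleast[l]; apply.
    apply/(elementary_definable eG (definable_atleast l dP) Guv).
    exact: infinite_atleast.
  have [x [Px NFx]] := infinite_setN0 (infinite_setD Pvinf fF).
  by exists x.
exists b; split=> [Nb|].
  have dne : definable (fun z : 'I_2 -> M => ~ z ord0 = z (lift ord0 ord0)).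
    exact/definable_not/definable_eq.
  have [p pP] := dne.
  have psatE x : psat (@PFormula L M 1 1 p (fun=> b)) (fun=> x) <-> x <> b.
    by rewrite /psat /= fcat_cons -pP !fconsE.
  apply: (psatE b).1 _ erefl; apply: bp.
  by split; [right|right; exists b].
suff imp n (p : formula L n) (t t' : 'I_n -> M) :
    (forall i, ((a, b) |` G) (t i, t' i)) -> sat p t -> sat p t'.
  move=> n p t t' Gt; split; first exact: imp.
  by apply: contraPP => Np; exact: (imp _ (FNot p) _ _ Gt).
move=> Gt pt.
have [n1 [n2 [u [w [r [uab wG ttE]]]]]] :=
  split_tuple (t := fun i => (t i, t' i)) Gt.
pose r' : 'I_n -> 'I_n2.+1 := fun i =>
  match fintype.split (r i) with inl _ => ord0 | inr j => lift ord0 j end.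
have E (f : M * M -> M) : fcons (f (a, b)) (f \o w) \o r' =
    f \o (fun i => (t i, t' i)).
  rewrite ttE; apply/funext => i; rewrite /r' /fcat /=.
  by case: fintype.split => j; rewrite fconsE//= uab.
have := bp (@PFormula L M 1 n2 (fren p r') (snd \o w)).
rewrite /psat /= fcat_cons sat_fren (E snd); apply; split.
  by move=> j; left; exists (w j).
left; exists (fst \o w) => /=.
  by move=> j /=; rewrite -surjective_pairing; exact: wG.
by rewrite sat_fren (E fst).
Qed.

End Elementary.

(** * Independence under exchange *)

(** Makes Zorn's lemma applicable below: elementarity and algebraic dependence involve finitely many
    points, hence one member of the chain. *)
Lemma chain_tuple (X : Type) (F : set (set X)) n (t : 'I_n -> X) :
    total_on F subset -> F !=set0 -> (forall i, (\bigcup_(Y in F) Y) (t i)) ->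
  exists2 Y, F Y & forall i, Y (t i).
Proof.
move=> Ftot [Y0 FY0]; elim: n t => [|n IH] t tF; first by exists Y0 => // -[].
have [i|Y FY Yt] := IH (t \o lift ord0); first exact: tF.
have [Z FZ Zt] := tF ord0.
have [YZ|ZY] := Ftot _ _ FY FZ; [exists Z|exists Y] => // i;
  case: (unliftP ord0 i) => [j|] -> //; last exact: ZY.
- exact/YZ/Yt.
- exact: Yt.
Qed.

Section Pregeometry.
Variables (U : Type) (HU : inaccessible U) (L : signature) (M : structure L).
Hypotheses (MU : [set: M] #<= [set: U]) (EX : exchange_property U M).
Implicit Types (A B C D E : set M) (x y : M).

Let small_range n (a : 'I_n -> M) : small U (range a).
Proof.
exact/small_countable/finite_set_countable/finite_image.
Qed.

Let smallU A B : small U A -> small U B -> small U (A `|` B).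
Proof. exact: small_setU. Qed.

#[local] Hint Resolve small_range smallU : core.

(** If x were in acl(yaD) but not in acl(aD), exchange would put y in acl(xaD), hence in acl(aD) by
    hypothesis, and so x in acl(aD) after all. The entries of the tuple can thus be removed one by
    one. *)
Lemma acl_drop_independent A D x :
    small U D ->
    (forall n (a : 'I_n -> M) y, A y -> from A a ->
       acl ([set x] `|` (range a `|` D)) y -> acl (range a `|` D) y) ->
  acl (A `|` D) x -> acl D x.
Proof.
move=> sD H /acl_finite_char[n [a [Aa]]].
elim: n a Aa => [|n IH] a Aa; first by rewrite range_I0 set0U.
rewrite (fcons_eta a) range_fcons -setUA => ax.
have Aa' : from A (a \o lift ord0) by move=> i; exact: Aa.
apply: (IH _ Aa'); apply: contrapT => Nx; apply: (Nx).
apply: (acl1_trans ax); apply: H => //.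
apply: EX Nx => //; exact: smallU.
Qed.

(** Use the previous lemma over bC: in a relation y in acl(xabC) both x and b come from B, so
    independence of A from B gives y in acl(aC). *)
Lemma indep_e_sym A C B : small U C -> indep_e A C B -> indep_e B C A.
Proof.
move=> sC AB n b Bb x [Bx]; rewrite setUAC setUC => bx.
apply: acl_drop_independent bx => [|k a y Ay Aa ay]; first exact: smallU.
apply: (@acl_mono _ _ (range a `|` C)).
  by apply: setUS; exact: subsetUr.
apply: (AB k a Aa); split=> //; apply: acl_mono ay => z [->|[az|[[i _ <-]|Cz]]].
- by left; right.
- by left; left.
- by left; right.
- by right.
Qed.

(** As D lies in acl(EC), so does a common point x of the two closures; hence x and D create no
    relation among elements of A. *)
Lemma indep_e_indep_M A C E : small U C -> indep_e A C E -> indep_M U A C E.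
Proof.
move=> sC AE D sD CD DE; apply/seteqP; split=> x; last first.
  by move=> Dx; split; apply: acl_mono Dx; exact: subsetUr.
move=> [ADx EDx].
have {}EDx : acl (E `|` C) x.
  apply: acl_sub_trans EDx => y [Ey|/DE//]; apply: sub_acl; by left.
apply: acl_drop_independent ADx => // n a y Ay Aa ay.
apply: (@acl_mono _ _ (range a `|` C)); first exact: setUS.
apply: (AE n a Aa); split=> //; rewrite -setUA; apply: acl_sub_trans ay.
move=> z [->|[az|/DE Dz]].
- by apply: acl_mono EDx; exact: subsetUr.
- by apply: sub_acl; left.
- by apply: acl_mono Dz; exact: subsetUr.
Qed.

Lemma indep_M_indep_e A C B : small U C -> indep_M U A C B -> indep_e A C B.
Proof.
move=> sC AB; apply: indep_e_sym => // n b Bb x [Bx bx].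
rewrite -(AB (range b `|` C)).
- split; last by apply: sub_acl; left.
  by apply: acl_mono bx => z [[]|] ?; [right; left|left|right; right].
- exact: smallU.
- exact: subsetUr.
- move=> z [[i _ <-]|Cz]; apply: sub_acl; [left; exact: Bb|by right].
Qed.

(* The image over E is built by Zorn's lemma on elementary graphs; an element
   outside the closure of the part of A already treated is sent outside the
   closure of E and of the part already built. *)
Lemma indep_e_extension A C B E :
    saturated M -> [set: M] #= [set: U] -> countable_signature L ->
    small U A -> small U C -> small U E -> B `|` C `<=` E ->
    indep_e A C B ->
  exists A', same_type_set (B `|` C) A A' /\ indep_e A' C E.
Proof.
move=> Msat MeU HL sA sC sE BCE AB.
pose idBC := [set xy : M * M | (B `|` C) xy.1 /\ xy.2 = xy.1].
pose img (G : set (M * M)) := [set y | exists2 x, A x & G (x, y)].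
(* [idBC] is added to [G] because the empty chain has empty union. [E] stands on the left so that a
   failure involves finitely many image points and adding one point is a matter of exchange;
   symmetry turns this round at the end. *)
pose P G := [/\ elementary (idBC `|` G), (forall xy, G xy -> A xy.1)
  & indep_e E C (img (idBC `|` G))].
have [|G [[eG GA iG] Gmax]] := @Zorn_bigcup _ P.
  move=> F FP Ftot; have [->|/set0P F0] := eqVneq F set0.
    rewrite bigcup_set0 /P setU0; split=> //; first exact: elementary_id.
    (* The image of [idBC] is the part of A in B or C, which lies in acl(C) by the hypothesis for
       the empty tuple. *)
    apply: (@indep_e_sym) => // n a Aa x [[x' Ax' /= [BCx xx]] _].
    rewrite /= in xx; subst x'.
    apply: (@acl_mono _ _ (range (@fnil M) `|` C)).
      by rewrite range_I0 set0U; exact: subsetUr.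
    apply: AB; first by case.
    by split=> //; apply: sub_acl; rewrite -setUA; right.
  have U1 : idBC `|` \bigcup_(G in F) G =
      \bigcup_(G in [set idBC `|` G | G in F]) G.
    rewrite bigcup_image; apply/seteqP.
    split=> [xy [Ixy|[G FG Gxy]]|xy [G FG [Ixy|Gxy]]].
    - by have [G FG] := F0; exists G => //; left.
    - by exists G => //; right.
    - by left.
    - by right; exists G.
  have F'tot : total_on [set idBC `|` G | G in F] subset.
    move=> _ _ [G FG <-] [G' FG' <-].
    by have [|] := Ftot _ _ FG FG'; [left|right]; exact: setUS.
  have F'0 : [set idBC `|` G | G in F] !=set0.
    by have [G FG] := F0; exists (idBC `|` G), G.
  split=> [n p a b|xy [G FG]|n e Ee x [Ex]].
  - rewrite U1 => /(chain_tuple (t := fun i => (a i, b i)) F'tot F'0).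
    by move=> [_ [G FG <-] Gab]; case: (FP _ FG) => eG _ _; exact: eG.
  - by case: (FP _ FG) => _ GA _; exact: GA.
  - rewrite setUAC setUC => /acl_finite_char[k [b [ib bx]]].
    have /choice[a ab] : forall i, exists a, A a /\
        (idBC `|` \bigcup_(G in F) G) (a, b i).
      by move=> i; have [a] := ib i; exists a.
    have := @chain_tuple _ _ _ (fun i => (a i, b i)) F'tot F'0.
    rewrite -U1 => /(_ (fun i => (ab i).2))[_ [G FG <-] Gab].
    case: (FP _ FG) => _ _ iG; apply: (iG n e Ee); split=> //.
    rewrite setUAC setUC; apply: acl_mono bx; apply: setSU => _ [i _ <-].
    by exists (a i) => //; case: (ab i).
pose G' := idBC `|` G.
have sG' : small U (snd @` G').
  have sABC : small U (A `|` E) by exact: smallU.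
  have /choice[f fP] : forall x, exists y, forall z, G' (x, z) -> y = z.
    move=> x; have [[z Gz]|N] := pselect (exists z, G' (x, z)).
      by exists z => z'; exact: elementary_fun Gz.
    by exists x => z Gz; case: N; exists z.
  apply: small_le sABC; apply: card_le_trans (card_image_le f _).
  apply: subset_card_le => _ [[x y] Gxy <-] /=; exists x; last exact: fP.
  by case: Gxy => [[/BCE Ex _]|/GA Ax]; [right|left].
have simg : small U (img G').
  by apply: small_sub sG' => y [x Ax Gxy]; exists (x, y).
have dom : forall x, A x -> exists y, G' (x, y).
  move=> a Aa; apply: contrapT => Na.
  pose Ad := [set x | A x /\ exists y, G' (x, y)].
  have [N [b [Nb eb ib]]] : exists (N : set M) b,
      [/\ ~ N b, elementary ((a, b) |` G')
        & indep_e E C ([set b] `|` img G')].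
    (* If [a] is algebraic over [Ad] and [C], then any image of it is algebraic over [img G'] and
       [C], and adds nothing. *)
    have [ad|nad] := pselect (acl (Ad `|` C) a).
      have [||b [_ eb]] := @elementary_extend _ _ G' set0 a Msat eG.
      - by rewrite setU0; exact: (small_card_lt MeU).
      - by left.
      exists set0, b; split=> //.
      have bi : acl (img G' `|` C) b.
        apply: elementary_acl eb _ _ ad; first by left.
        move=> s [[As [y Gsy]]|Cs]; first by exists y; [left; exists s|right].
        by exists s; [right|right; left; split=> //; right].
      move=> n e Ee x [Ex ex]; apply: (iG n e Ee); split=> //.
      apply: acl_sub_trans ex => z [[ez|[->|iz]]|Cz].
      - by apply: sub_acl; left; left.
      - by apply: acl_mono bi; apply: setSU; exact: subsetUr.
      - by apply: sub_acl; left; right.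
      - by apply: sub_acl; right.
    have [||b [Nb eb]] :=
      @elementary_extend _ _ G' (acl (img G' `|` E)) a Msat eG.
    - apply/(small_card_lt MeU)/smallU => //.
      by apply: small_acl => //; exact: smallU.
    (* By independence from [B], a point of [A] algebraic over [Ad], [B] and [C] is algebraic over
       [Ad] and [C]. *)
    - right=> /(acl_mono (B := Ad `|` (B `|` C))) H; apply: nad.
      have /acl_finite_char[n [d [Add dx]]] : acl (Ad `|` (B `|` C)) a.
        apply: H => _ [[x y] Gxy <-] /=.
        case: (Gxy) => [[BCx _]|/GA Ax]; first by right.
        by left; split=> //; exists y.
      apply: (@acl_mono _ _ (range d `|` C)).
        by apply: setSU => _ [i _ <-].
      apply: (AB n d) => [i|]; first by case: (Add i).
      by split=> //; rewrite -setUA.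
    (* A new dependence of some [x] in [E] on [b] would by exchange make [b] algebraic over [E] and
       the image. *)
    exists (acl (img G' `|` E)), b; split=> // n e Ee x [Ex ex].
    apply: (iG n e Ee); split=> //; apply: contrapT => Nx; apply: Nb.
    have : acl ([set x] `|` (range e `|` img G' `|` C)) b.
      apply: EX Nx; first by do 2!apply: smallU => //.
      by rewrite setUA [_ `|` (range e `|` _)]setUCA.
    apply: acl_mono => z [->|[[[i _ <-]|iz]|Cz]].
    - by right.
    - by right; exact: Ee.
    - by left.
    - by right; apply: BCE; right.
  apply: (Gmax ((a, b) |` G)).
    split=> [xy Gxy|/(_ (a, b) (or_introl erefl)) Gab]; first by right.
    by apply: Na; exists b; right.
  have GE : idBC `|` ((a, b) |` G) = (a, b) |` G' by rewrite setUCA.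
  split; rewrite ?GE//; first by move=> xy [->|/GA].
  move=> n e Ee x [Ex ex]; apply: (ib n e Ee); split=> //; apply: acl_mono ex.
  apply: setSU; apply: setUS => y [x' Ax' [[_ ->]|Gx'y]]; first by left.
  by right; exists x'.
have /choice[f fP] : forall x, exists y, A x -> G' (x, y).
  move=> x; have [/dom[y Gxy]|N] := pselect (A x); first by exists y.
  by exists x.
exists (f @` A); split.
  exists f; split=> // n a Aa; apply: same_type_elementary eG _ fP _ _ Aa.
  by move=> c BCc; left.
apply: indep_e_sym => // n e Ee x [Ex ex]; apply: (iG n e Ee); split=> //.
apply: acl_mono ex; apply: setSU; apply: setUS => _ [a Aa <-].
by exists a => //; exact: fP.
Qed.

Lemma indep_e_th A C B :
    saturated M -> [set: M] #= [set: U] -> countable_signature L ->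
    small U A -> small U C ->
  indep_e A C B -> indep_th U A C B.
Proof.
move=> Msat MeU HL sA sC AB E sE BCE.
have [A' [AA' A'E]] := indep_e_extension Msat MeU HL sA sC sE BCE AB.
by exists A'; split=> //; exact: indep_e_indep_M.
Qed.

(** The choice E = BC is enough: the elementary map from A to A' fixes BC, so dependences go over to
    A' and back. *)
Lemma indep_th_e A C B : small U C -> small U B ->
  indep_th U A C B -> indep_e A C B.
Proof.
move=> sC sB AB.
have [|//|A' [[f [fA st]] /indep_M_indep_e A'B]] := AB (B `|` C).
  exact: smallU.
have eG := elementary_same_type st.
move=> n a Aa x [Ax ax].
apply: (elementary_acl (elementary_inv eG) (x := f x)
  (S := range (f \o a) `|` C)).
- by left.
- move=> s [[i _ <-]|Cs].
    by exists (a i); [left; exists i|left; split=> //; exact: Aa].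
  by exists s; [right|right; split=> //; right].
apply: A'B => //.
  by move=> i; rewrite -fA; exists (a i).
split; first by rewrite -fA; exists x.
apply: (elementary_acl eG) ax; first by left.
move=> s [[[i _ <-]|Bs]|Cs].
- by exists (f (a i)); [left; left; exists i|left; split=> //; exact: Aa].
- by exists s; [left; right; left|right; split=> //; left].
- by exists s; [right|right; split=> //; right].
Qed.

(* C consists of supports in B of the elements of A over a basis A0 of A over
   B; then A0 stays independent over B and A is contained in acl (A0 C). *)
Lemma indep_e_small_local_character A B C0 :
    small U A -> small U B -> C0 `<=` B -> C0 #<= plus_aleph0 A ->
  exists C, [/\ C0 `<=` C, C `<=` B, C #<= plus_aleph0 A & indep_e A C B].
Proof.
move=> sA sB C0B C0A.
pose P (Y : set M) := Y `<=` A /\ forall y, Y y -> ~ acl ((Y `\ y) `|` B) y.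
have [|A0 [[A0A A0ind] A0max]] := @Zorn_bigcup _ P.
  move=> F FP Ftot; split=> [y [Y FY Yy]|y [Y FY Yy]].
    by case: (FP _ FY) => YA _; exact: YA.
  move=> /acl_finite_char[n [a [Fa ay]]].
  have [i|Z FZ Za] := @chain_tuple _ F n.+1 (fcons y a) Ftot (ex_intro _ Y FY).
    case: (unliftP ord0 i) => [j|] ->; rewrite fconsE; last by exists Y.
    by case: (Fa j).
  case: (FP _ FZ) => _ /(_ y); apply; first by have := Za ord0; rewrite fconsE.
  apply: acl_mono ay; apply: setSU => _ [i _ <-]; split; last by case: (Fa i).
  by have := Za (lift ord0 i); rewrite fconsE.
have sA0 : small U A0 by exact: small_sub sA.
have span a : A a -> acl (A0 `|` B) a.
  move=> Aa; apply: contrapT => Na; apply: (A0max (a |` A0)).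
    split=> [y A0y|/(_ a (or_introl erefl)) A0a]; first by right.
    by apply: Na; apply: sub_acl; left.
  split=> [y [->|/A0A]//|y [->|A0y]].
    apply: contra_not Na; apply: acl_mono; apply: setSU => z [[->|//]].
    by case.
  have [-> |ya] := pselect (y = a).
    apply: contra_not Na; apply: acl_mono; apply: setSU => z [[->|//]].
    by case.
  move=> H; apply: Na.
  (* As [A0] is independent, the dependence of [y] must use [a]; exchange then makes [a] algebraic
     over [A0] and [B]. *)
  have {}H : acl ([set a] `|` ((A0 `\ y) `|` B)) y.
    apply: acl_mono H => z [[[->|A0z] zy]|Bz]; first by left.
      by right; left.
    by right; right.
  have sA0y : small U (A0 `\ y `|` B).
    by apply: smallU => //; apply: small_sub sA0; exact: subDsetl.
  have := EX sA0y H (A0ind y A0y).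
  by apply: acl_mono => z [->|[[]|]]; [left|left|right].
have /choice[S SP] : forall a, exists S : set M, A a ->
    [/\ countable S, S `<=` B & acl (A0 `|` S) a].
  move=> a; have [Aa|Na] := pselect (A a); last by exists set0.
  have := span a Aa; rewrite setUC => /acl_finite_char[n [b [Bb ba]]].
  exists (range b) => _; split.
  - exact/finite_set_countable/finite_image.
  - by move=> _ [i _ <-].
  - by rewrite setUC.
pose C := C0 `|` \bigcup_(a in A) S a.
have CB : C `<=` B by move=> x [/C0B//|[a /SP[_ SB _] /SB]].
exists C; split=> //; first exact: subsetUl.
  apply: card_le_bigcup_countable => //.
  - exact: infinite_plus_aleph0.
  - exact: card_le_plus_aleph0.
  - by move=> a /SP[].
have AC : A `<=` acl (A0 `|` C).
  move=> a Aa; have [_ _] := SP a Aa; apply: acl_mono; apply: setUS => x Sx.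
  by right; exists a.
have sC : small U C by exact: small_sub sB.
apply: indep_e_sym => // n b Bb x [Bx bx].
apply: (@acl_drop_independent A0).
- exact: smallU.
(* An element of [A0] depends on [B] and a tuple from [A0] only if it occurs in the tuple. *)
- move=> k a y A0y A0a ay; have [[i _ <-]|Na] := pselect (range a y).
    by apply: sub_acl; left; exists i.
  case: (A0ind _ A0y); apply: acl_mono ay.
  move=> z [->|[[i _ <-]|[[i _ <-]|/CB Bz]]]; try by right.
  by left; split=> // ay; apply: Na; exists i.
apply: acl_sub_trans bx => z [[bz|/AC]|Cz].
- by apply: sub_acl; right; left.
- by apply: acl_mono; apply: setUS; exact: subsetUr.
- by apply: sub_acl; right; right.
Qed.

End Pregeometry.

(** * Exchange from independence *)

Section Exchange.
Variables (U : Type) (HU : inaccessible U) (L : signature) (M : structure L).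

(** A nonempty tuple from {b} contains b, so only the empty tuple imposes a condition. *)
Lemma indep_e_set1 (C : set M) a b :
  ~ acl ([set a] `|` C) b -> indep_e [set b] C [set a].
Proof.
move=> Nb [|n] u ub x [->].
  by rewrite range_I0 set0U => /Nb.
by move=> _; apply: sub_acl; left; exists ord0 => //; exact: ub.
Qed.

(** Test with E = aC: the elementary map fixes a, so a stays algebraic over A'C, and M-independence
    at D = C puts it into acl(C). *)
Lemma exchange_of_indep_th :
  [set: M] #<= [set: U] ->
  trel_eq U (@indep_th U L M) (@indep_e L M) -> exchange_property U M.
Proof.
move=> MU the a b C sC ba Na; apply: contrapT => /indep_e_set1 be.
have saC : small U ([set a] `|` C).
  by apply: small_setU => //; exact: small_set1.
have [//|A' [[f [fA st]] A'M]] :=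
  (the _ _ _ (small_set1 HU b) sC (small_set1 HU a)).2 be ([set a] `|` C) saC.
have eG := elementary_same_type st.
apply: Na; rewrite -(A'M C sC) //; last by move=> x Cx; apply: sub_acl; right.
split; last by apply: sub_acl; left; left.
apply: (elementary_acl eG) ba; first by right; split=> //; left.
move=> s [->|Cs]; first by exists (f b); [left; rewrite -fA; exists b|left].
by exists s; [right|right; split=> //; right].
Qed.

(* If a is algebraic over bC, then some formula phi(a, y) satisfied by b bounds
   the number of solutions of phi(x, y) in x; as a has infinitely many
   conjugates over C, phi(a, y) divides over C. *)
Lemma exchange_of_indep_d :
  [set: M] #= [set: U] -> saturated M ->
  trel_eq U (@indep_d L M) (@indep_e L M) -> exchange_property U M.
Proof.
move=> MeU Msat de a b C sC ba Na; apply: contrapT => /indep_e_set1 be.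
apply: (de _ _ _ (small_set1 HU b) sC (small_set1 HU a)).2 be _.
have [m [P [c [dP Cc fin Pab]]]] := acl1P ba.
have [k Nk] := finite_atleast fin.
pose idC := [set xy : M * M | C xy.1 /\ xy.2 = xy.1].
pose conj := [set x | elementary ((a, x) |` idC)].
(* A finite [conj] could be avoided by a further conjugate, as [a] is not algebraic over [C]. *)
have conj_inf : infinite_set conj.
  move=> conj_fin.
  have [||x [Nx ex]] :=
    @elementary_extend _ _ idC conj a Msat (@elementary_id _ _ C);
    last exact: Nx.
    apply/(small_card_lt MeU)/small_setU => //.
    - by have /card_eqPle[] := MeU.
    - by apply: small_sub sC => _ [[x y] [/= Cx ->] <-].
    - exact/small_countable/finite_set_countable.
  right; apply: contra_not Na; apply: acl_mono => _ [[x y] [/= Cx _] <-] //.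
have [g [conjg ginj]] : exists g : nat -> M,
    (forall i, conj (g i)) /\ injective g.
  have /infiniteP/(card_le_set_inj a)[g [gc ginj]] := conj_inf.
  by exists g; split=> [i|i j]; [exact: gc|exact: ginj].
pose sw : 'I_m.+2 -> 'I_m.+2 := fcons (lift ord0 ord0)
  (fcons ord0 (lift ord0 \o lift ord0)).
have swE x y (d : 'I_m -> M) :
    fcons x (fcons y d) \o sw = fcons y (fcons x d).
  rewrite !comp_fcons !fconsE; do 2!congr fcons; apply/funext => i /=.
  by rewrite !fconsE.
pose tl : 'I_m.+2 -> 'I_m.+3 := fcons ord0 (fcons (lift ord0 ord0)
  (lift ord0 \o (lift ord0 \o lift ord0))).
have tlE z x y (d : 'I_m -> M) :
    fcons z (fcons x (fcons y d)) \o tl = fcons z (fcons x d).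
  rewrite !comp_fcons !fconsE; do 2!congr fcons; apply/funext => i /=.
  by rewrite !fconsE.
(* [p] is read at [(y, x, d)]: the object variable y comes first, and x, to be filled by [a], has
   become a parameter. *)
have [p pE] := definable_and (definable_ren sw dP)
  (definable_not (definable_atleast k (definable_ren tl dP))).
have {}pE x y d : sat p (fcons y (fcons x d)) <->
    P (fcons x (fcons y d)) /\ ~ atleast k [set z | P (fcons z (fcons y d))].
  rewrite -pE swE (_ : [set z | _] = [set z | P (fcons z (fcons y d))])//.
  by apply/funext => z /=; rewrite tlE.
exists 1, (fun=> b), (@PFormula L M 1 m.+1 p (fcons a c)); split=> //.
- apply: from_fcons; first by left.
  by move=> i; right; exact: Cc.
- by rewrite /psat /= fcat_cons; apply/pE.
(* The same [k] serves for inconsistency: [k] distinct conjugates would be [k] solutions of P(., y,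
   c). *)
exists (fun i => fcons (g i) c), k; split=> [i|s sinj [x Hx]] /=.
  move=> q Cq; apply: iff_sym; apply: (conjg i) => j.
  case: (split_ordP j) => j' ->; rewrite !fcatE.
    by case: (unliftP ord0 j') => [j''|] ->; rewrite !fconsE;
      [right; split=> //; exact: Cc|left].
  by right; split=> //; exact: Cq.
(* An index is needed from which to read the negated clause; [k = 0] is excluded as [atleast 0]
   always holds. *)
have k0 : (0 < k)%N.
  case: k Nk {pE s sinj Hx} => // -[]; exists (@fnil _).
  by split=> -[].
have {}Hx j : P (fcons (g (s j)) (fcons (x ord0) c)) /\
    ~ atleast k [set z | P (fcons z (fcons (x ord0) c))].
  by apply/pE; have := Hx j; rewrite fcat_cons.
apply: (Hx (Ordinal k0)).2; exists (g \o s); split=> [i j /ginj/sinj//|j].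
by case: (Hx j).
Qed.

End Exchange.

(** * The finite case, and the three claims together *)

Lemma finite_model_indep (U : Type) (L : signature) (M : structure L) :
  finite_set [set: M] ->
  (forall A C B : set M, indep_e A C B) /\
  (forall A C B : set M, indep_th U A C B).
Proof.
move=> fM; split=> A C B.
  by move=> n a _ x _; rewrite acl_finite.
move=> E _ _; exists A.
split; last by move=> D *; rewrite /indep_a !acl_finite ?setIT.
by exists id; split=> [|n a _ p _ //]; rewrite image_id.
Qed.

Theorem theorem3p2p3 (U : Type) (L : signature) (T : set (sentence L))
    (M : structure L) (HU : inaccessible U) (HL : countable_signature L)
    (HT : complete_theory T) (HM : big_model U T M) :
  (exchange_property U M <->
     real_rosy U M /\ trel_eq U (@indep_th U L M) (@indep_e L M)) /\
  (exchange_property U M -> small_local_character U (@indep_th U L M)) /\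
  (stable M -> trel_eq U (@indep_d L M) (@indep_e L M) ->
     exchange_property U M).
Proof.
have rosy : small_local_character U (@indep_th U L M) -> real_rosy U M.
  move=> slc A sA; have [K [KU AK]] := small_lt_card HU sA.
  exists K; split=> // B sB.
  have s0 : small U (@set0 M) by apply: small_countable.
  have [C [_ CB CA thC]] := slc A B set0 sA sB s0 (@sub0set _ _) (card_ge0 _ _).
  by exists C; split=> //; exact: AK.
case: HM => _ [fM|[MeU Msat]].
  have [ie ith] := finite_model_indep U fM.
  have EX : exchange_property U M by move=> a b C _ _ _; rewrite acl_finite.
  have slc : small_local_character U (@indep_th U L M).
    by move=> A B C0 _ _ _ C0B C0A; exists C0; split.
  by split=> //; split=> // _; split; [exact: rosy|].
have MU : [set: M] #<= [set: U] by have /card_eqPle[] := MeU.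
have slc : exchange_property U M -> small_local_character U (@indep_th U L M).
  move=> EX A B C0 sA sB sC0 C0B C0A.
  have [C [C0C CB CA eC]] :=
    indep_e_small_local_character HU MU EX sA sB C0B C0A.
  exists C; split=> //; apply: indep_e_th => //; exact: small_sub sB.
split; last first.
  by split=> // _; exact: exchange_of_indep_d.
split=> [EX|[_]]; last exact: exchange_of_indep_th.
split; first exact/rosy/slc.
move=> A C B sA sC sB; split; first exact: indep_th_e.
exact: indep_e_th.
Qed.
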